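(* For any positive integer $n$, the polynomial $$\ell_I(\Gamma(B_n),x)=\sum_{i=1}^{\lfloor n/2\rfloor}\binom{n}{i}\binom{n-i-1}{i-1}x^i(1+x)^{n-2i}$$ has only real zeros.
   Context: This polynomial is the local $h$-polynomial of the type $B_n$ cluster subdivision. A polynomial has only real zeros if all of its complex zeros are real.
   Formalization: For n = 1 the sum is empty and the polynomial is zero, so not all of its complex zeros are real; the formal statement adopts the convention that the zero polynomial counts as having only real zeros (this matters only for n = 1). *)

(* Defs.v *)
From mathcomp Require Import all_boot all_order all_algebra.
From mathcomp Require Import reals.
From mathcomp Require Import complex.

Set Implicit Arguments.
Unset Strict Implicit.
Unset Printing Implicit Defensive.

Import Order.TTheory GRing.Theory Num.Theory.
Local Open Scope ring_scope.
Local Open Scope complex_scope.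

(* The explicit form of the local h-polynomial l_I(Gamma(B_n), x) of the
   type B_n cluster subdivision. No subtraction truncates: 1 <= i <= n./2
   gives 2 * i <= n and i + 1 <= n. For n = 1 the sum is empty and the
   polynomial is 0. *)
Definition local_h_B (R : realType) (n : nat) : {poly R} :=
  \sum_(1 <= i < (n./2).+1)
     ('C(n, i) * 'C(n - i - 1, i - 1))%:R *: ('X^i * (1 + 'X) ^+ (n - 2 * i)).

(* All complex zeros of p are real. The zero polynomial, of which every
   complex number is a root, counts as having only real zeros, as is usual
   in the theory of real-rooted polynomials. *)
Definition has_only_real_zeros (R : realType) (p : {poly R}) : Prop :=
  p = 0 \/
  forall z : R[i], root (map_poly (real_complex R) p) z -> complex.Im z = 0.

(* Main.v *)
Require Import Defs.
From mathcomp Require Import all_boot all_order all_algebra.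
From mathcomp Require Import reals.
From mathcomp Require Import complex.
From mathcomp Require Import ring zify.

Set Implicit Arguments.
Unset Strict Implicit.
Unset Printing Implicit Defensive.

Import Order.TTheory GRing.Theory Num.Theory.
Local Open Scope ring_scope.

(** The local h-polynomial is [(1 + x) ^+ n * g (x / (1 + x) ^+ 2)] with
    [g y = sum_i 'C(n, i) 'C(n - i - 1, i - 1) y ^+ i], so it suffices that [g]
    has only real zeros; these are then nonpositive because the coefficients
    are. The polynomial [sum_i 'C(n - i - 1, i - 1) y ^+ i] is a Fibonacci
    polynomial, real-rooted by Binet's formula. Multiplying the coefficients
    by ['C(n, i)] preserves real-rootedness, since this is obtained by two
    applications of the Hermite-Poulain theorem: [q(D) p] is real-rooted
    whenever [q] and [p] are. *)

Definition real_rooted (C : numClosedFieldType) (p : {poly C}) : Prop :=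
  p = 0 \/ forall z, root p z -> z \is Num.real.

Lemma real_rooted_split (C : numClosedFieldType) (p : {poly C}) :
  real_rooted p ->
  exists c, exists2 rs : seq C, {subset rs <= Num.real} &
    p = c *: \prod_(a <- rs) ('X - a%:P).
Proof.
case=> [->|p_real]; first by exists 0, [::]; rewrite ?scale0r.
have [rs p_split] := closed_field_poly_normal p.
have [p0|p_neq0] := eqVneq p 0; first by exists 0, [::]; rewrite ?scale0r.
exists (lead_coef p), rs => // a a_rs; apply: p_real.
by rewrite p_split rootZ ?lead_coef_eq0 // root_prod_XsubC.
Qed.

Lemma deriv_prod_XsubC_horner (F : fieldType) (rs : seq F) (z : F) :
  z \notin rs ->
  (\prod_(a <- rs) ('X - a%:P))^`().[z] =
  (\prod_(a <- rs) ('X - a%:P)).[z] * \sum_(a <- rs) (z - a)^-1.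
Proof.
elim: rs => [|a rs IHrs]; first by rewrite !big_nil derivC horner0 mulr0.
rewrite inE negb_or => /andP[z_neq_a z_rs].
have za_neq0 : z - a != 0 by rewrite subr_eq0.
rewrite !big_cons derivM derivXsubC mul1r !hornerE IHrs //.
by field.
Qed.

(* For [z] off the real axis, the imaginary part of p'(z)/p(z) is a sum of
   terms all having the sign opposite to that of [z], so it vanishes only when
   [p] is constant. *)
Lemma real_rooted_derivB (C : numClosedFieldType) (p : {poly C}) (r : C) :
  r \is Num.real -> real_rooted p -> real_rooted (p^`() - r *: p).
Proof.
move=> r_real /real_rooted_split[c [rs rs_real ->{p}]].
set q := _ - _; have [q0|q_neq0] := eqVneq q 0; [by left|right => z].
apply: contraLR => z_nreal.
have z_rs : z \notin rs by apply: contra z_nreal => /rs_real.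
have c_neq0 : c != 0.
  by apply: contra_neq q_neq0 => c0; rewrite /q c0 scale0r derivC scaler0 subr0.
have prod_neq0 : (\prod_(a <- rs) ('X - a%:P)).[z] != 0.
  by rewrite -/(root _ z) root_prod_XsubC.
rewrite /root /q derivZ hornerD hornerN !hornerZ deriv_prod_XsubC_horner //.
set P := (\prod_(_ <- _) _).[z] in prod_neq0 *; set S := \sum_(_ <- _) _.
have -> : c * (P * S) - r * (c * P) = c * P * (S - r) by ring.
rewrite !mulf_eq0 !negb_or c_neq0 prod_neq0 /= subr_eq0.
apply: contraNneq q_neq0 => sum_r.
have z_im : 'Im z != 0 by apply: contraNneq z_nreal => /Creal_ImP.
have sum0 : \sum_(a <- rs) `|z - a| ^- 2 = 0.
  apply/eqP; rewrite -(mulrI_eq0 _ (mulfI z_im)) -oppr_eq0; apply/eqP.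
  rewrite mulr_sumr -sumrN; move/Creal_ImP: r_real; rewrite -sum_r raddf_sum /=.
  move=> sum_im; rewrite -[RHS]sum_im; apply: eq_big_seq => a /rs_real a_real.
  by rewrite ImV raddfB /= (Creal_ImP _ a_real) subr0 mulNr.
have rs_nil : rs = [::].
  move: z_rs sum0; clear; case: rs => // a rs.
  rewrite inE negb_or => /andP[z_a _]; rewrite big_cons => /eqP.
  rewrite paddr_eq0 ?invr_ge0 ?exprn_ge0 ?sumr_ge0 // => [/andP[]|b _].
    by rewrite invr_eq0 expf_eq0 normr_eq0 subr_eq0 (negPf z_a).
  by rewrite invr_ge0 exprn_ge0.
(* With no roots, [S] is an empty sum, so [r = 0] and [q] is the derivative of a constant. *)
move: sum_r; rewrite /q /S rs_nil !big_nil => <-.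
by rewrite scale0r subr0 derivZ derivC scaler0.
Qed.

Definition diffop (R : nzRingType) (q p : {poly R}) : {poly R} :=
  \sum_(i < size q) q`_i *: p^`(i).

Lemma diffop_widen (R : nzRingType) (N : nat) (q p : {poly R}) :
  (size q <= N)%N -> diffop q p = \sum_(i < N) q`_i *: p^`(i).
Proof.
move=> q_N; rewrite /diffop (big_ord_widen _ (fun i => q`_i *: p^`(i)) q_N).
rewrite big_mkcond; apply: eq_bigr => i _; case: ltnP => // q_i.
by rewrite nth_default ?scale0r.
Qed.

(** Products of symbols act as compositions of operators, so a linear factor of the symbol can be
    peeled off as [D - a]. *)
Lemma diffop_mul_XsubC (R : comNzRingType) (q p : {poly R}) (a : R) :
  diffop (('X - a%:P) * q) p = diffop q (p^`() - a *: p).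
Proof.
pose N := maxn (size q) (size (('X - a%:P) * q)).
rewrite (@diffop_widen _ N.+1) ?(leqW (leq_maxr _ _)) //.
rewrite (@diffop_widen _ N q) ?leq_maxl //.
under eq_bigr => i _ do rewrite mulrBl coefB coefXM coefCM scalerBl.
under [RHS]eq_bigr => i _ do
  rewrite derivnB derivnZ scalerBr scalerA [_ * a]mulrC -derivSn derivnS.
rewrite !sumrB big_ord_recl /= scale0r add0r; congr (_ - _).
by rewrite big_ord_recr /= nth_default ?leq_maxl // mulr0 scale0r addr0.
Qed.

Lemma real_rooted_diffop (C : numClosedFieldType) (q p : {poly C}) :
  real_rooted q -> real_rooted p -> real_rooted (diffop q p).
Proof.
case/real_rooted_split=> c [rs rs_real ->].
elim: rs p rs_real => [|a rs IHrs] p rs_real p_real.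
  rewrite big_nil (@diffop_widen _ 1) ?(leq_trans (size_scale_leq _ _)) ?size_poly1 //.
  rewrite big_ord1 coefZ coefC mulr1 derivn0.
  have [->|c_neq0] := eqVneq c 0; first by left; rewrite scale0r.
  case: p_real => [->|p_real]; first by left; rewrite scaler0.
  by right=> z; rewrite rootZ // => /p_real.
rewrite big_cons scalerAr diffop_mul_XsubC; apply: IHrs.
  by move=> b b_rs; apply: rs_real; rewrite inE b_rs orbT.
by apply: real_rooted_derivB => //; apply: rs_real; rewrite mem_head.
Qed.

Lemma real_rooted_Xn (C : numClosedFieldType) (n : nat) :
  real_rooted ('X^n : {poly C}).
Proof.
right=> z; rewrite /root hornerXn expf_eq0 => /andP[_ /eqP->].
exact: real0.
Qed.

Lemma diffop_Xn (R : nzRingType) (n m : nat) (q : {poly R}) :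
  (size q <= m.+1)%N ->
  diffop q 'X^n = \sum_(i < m.+1) (q`_i * (n ^_ i)%:R) *: 'X^(n - i).
Proof.
move=> /diffop_widen->; apply: eq_bigr => i _.
by rewrite derivnXn -scaler_nat scalerA.
Qed.

(* With [q] the hypothesis polynomial, [q(D) X^m] multiplies each [a i] by
   [m! / i!], and applying the result as an operator to [X^n] turns that into
   [m! 'C(n, i)]. *)
Lemma real_rooted_bin_mul (C : numClosedFieldType) (n m : nat) (a : nat -> C) :
  real_rooted (\poly_(k < m.+1) a (m - k)%N) ->
  real_rooted (\sum_(i < m.+1) (a i * 'C(n, i)%:R) *: 'X^(n - i)).
Proof.
set q := \poly_(k < _) _ => q_real.
have fact_neq0 : m`!%:R != 0 :> C by rewrite pnatr_eq0 -lt0n fact_gt0.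
(* [D^k] sends [X^m] to degree [m - k]; the reversal in [q] thus puts [a i] back at degree [i]. *)
have qm : diffop q 'X^m = \poly_(i < m.+1) (a i * (m ^_ (m - i))%:R).
  rewrite (diffop_Xn _ (size_poly _ _)) [RHS]poly_def (reindex_inj rev_ord_inj) /=.
  apply: eq_bigr => i _; rewrite coef_poly subSS ltnS leq_subr subKn //.
  by rewrite -ltnS.
have := real_rooted_diffop (real_rooted_diffop q_real (real_rooted_Xn _ m))
                           (real_rooted_Xn _ n).
rewrite qm (diffop_Xn _ (size_poly _ _)).
have -> : \sum_(i < m.+1)
    ((\poly_(i < m.+1) (a i * (m ^_ (m - i))%:R))`_i * (n ^_ i)%:R) *: 'X^(n - i)
    = m`!%:R *: \sum_(i < m.+1) (a i * 'C(n, i)%:R) *: 'X^(n - i) :> {poly C}.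
  rewrite scaler_sumr; apply: eq_bigr => i _.
  have i_m : (i <= m)%N by rewrite -ltnS.
  rewrite coef_poly ltn_ord scalerA -(bin_ffact n i) natrM.
  rewrite -(ffact_fact (leq_subr i m)) subKn // natrM; congr (_ *: _); ring.
case=> [/eqP|W_real].
  by rewrite scaler_eq0 (negPf fact_neq0) => /eqP; left.
by right=> z z_root; apply: W_real; rewrite rootZ.
Qed.

(** At [y = 1] this is a Fibonacci number. The terms with [2 * j > n] vanish; keeping them avoids a
    parity split in the recurrence. *)
Definition fib_sum (R : nzRingType) (n : nat) (y : R) : R :=
  \sum_(j < n.+1) 'C(n - j, j)%:R * y ^+ j.

Lemma fib_sumSS (R : comNzRingType) (n : nat) (y : R) :
  fib_sum n.+2 y = fib_sum n.+1 y + y * fib_sum n y.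
Proof.
rewrite /fib_sum big_ord_recl [in RHS]big_ord_recl /= !bin0 !expr0 !mulr1 -addrA.
congr (_ + _); rewrite big_ord_recr /= !subSS subnn bin0n mul0r addr0.
rewrite mulr_sumr -big_split /=; apply: eq_bigr => i _.
rewrite /bump /= !add1n !subSS subSn; last by rewrite -ltnS.
rewrite binS natrD exprS; ring.
Qed.

(* Binet's formula for the roots [u] and [1 - u] of [t^2 - t - y]. *)
Lemma fib_sum_Binet (R : comNzRingType) (n : nat) (u : R) :
  (u - (1 - u)) * fib_sum n (- (u * (1 - u))) = u ^+ n.+1 - (1 - u) ^+ n.+1.
Proof.
suff [] : (u - (1 - u)) * fib_sum n (- (u * (1 - u))) = u ^+ n.+1 - (1 - u) ^+ n.+1
  /\ (u - (1 - u)) * fib_sum n.+1 (- (u * (1 - u))) = u ^+ n.+2 - (1 - u) ^+ n.+2.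
  by [].
elim: n => [|n [IH0 IH1]].
  rewrite /fib_sum !big_ord_recl !big_ord0 /bump /= !subn0 !bin0 subnn bin0n mul0r.
  by split; ring.
split=> //; rewrite fib_sumSS mulrDr IH1 mulrCA IH0 !exprS; ring.
Qed.

(* If [fib_sum n y = 0] then [u ^+ n.+1 = (1 - u) ^+ n.+1], so that
   [`|u| = `|1 - u|]; hence [1 - u] is the conjugate of [u], and
   [y = - `|u| ^+ 2]. *)
Lemma fib_sum_root_real (C : numClosedFieldType) (n : nat) (y : C) :
  fib_sum n y = 0 -> y \is Num.real.
Proof.
pose u := (1 + sqrtC (1 + 4 * y)) / 2.
have y_u : y = - (u * (1 - u)).
  have := sqrtCK (1 + 4 * y); rewrite /u; set s := sqrtC _ => s2.
  have -> : y = (s ^+ 2 - 1) / 4 by rewrite s2; field.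
  by field.
move=> fib0; have := fib_sum_Binet n u.
rewrite -y_u fib0 mulr0 => /esym/subr0_eq/(congr1 Num.norm).
rewrite !normrX => /eqP; rewrite eqrXn2 // => /eqP norm_u.
have re_u : 1 - u = u^*.
  have := congr1 (fun x => x ^+ 2) norm_u; rewrite /= !normCK.
  rewrite rmorphB rmorph1 => h.
  have -> : u^* = 1 - u + (u * u^* - (1 - u) * (1 - u^*)) by ring.
  by rewrite h subrr addr0.
by rewrite y_u re_u -normCK realN realX ?normr_real.
Qed.

(** The value 0 at [i = 0] lets sums that start at 1 run over ordinals. *)
Definition fib_coef (n i : nat) : nat :=
  if i is i'.+1 then 'C(n - i - 1, i') else 0.

(** At [z != 0] this reversed polynomial is a power of [z] times [fib_sum (n - 2)] at [z^-1]. *)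
Lemma real_rooted_fib (C : numClosedFieldType) (n : nat) : (1 < n)%N ->
  real_rooted (\poly_(k < (n./2).+1)
     (fib_coef n (n./2 - k))%:R : {poly C}).
Proof.
case: n => [|[|n]] // _; right=> z.
have [->|z_neq0] := eqVneq z 0; first by rewrite real0.
set m := (n./2).
have -> : (n.+2)./2 = m.+1 by [].
rewrite /root horner_poly /= => /eqP z_root.
suff : fib_sum n z^-1 = 0 by move/fib_sum_root_real; rewrite realV.
rewrite /fib_sum.
have m_n : (m.+1 <= n.+1)%N by rewrite ltnS; lia.
rewrite (bigID (fun i : 'I_n.+1 => (i < m.+1)%N)) /=.
rewrite [X in _ + X]big1 ?addr0; last first.
  by move=> i; rewrite -leqNgt => m_i; rewrite bin_small ?mul0r //; lia.
rewrite -(big_ord_widen _ (fun i => 'C(n - i, i)%:R * z^-1 ^+ i) m_n).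
(* The factor is [z ^+ m], not [z ^+ m.+1]: the top coefficient is [fib_coef] at 0. *)
apply: (mulfI (expf_neq0 m z_neq0)); rewrite mulr0 -[RHS]z_root.
rewrite [RHS]big_ord_recr /= subnn mul0r addr0 mulr_sumr.
rewrite (reindex_inj rev_ord_inj) /=; apply: eq_bigr => i _.
have i_m : (i <= m)%N by rewrite -ltnS.
rewrite subSS subSn // [X in _ = 'C(X, _)%:R * _](_ : _ = n - (m - i))%N; last by lia.
rewrite mulrCA; congr (_ * _); rewrite exprVn -{1}(subnK i_m) exprD.
by rewrite mulrAC mulfV ?mul1r ?expf_neq0.
Qed.

(* Dividing the sum by [(1 + z) ^+ n] makes it a polynomial in
   [z / (1 + z) ^+ 2], whose reverse is the real-rooted polynomial above
   evaluated at [w = (1 + z) ^+ 2 / z]. If [w] is real but [z] is not, then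
   [`|z| = 1] and [w = `|1 + z| ^+ 2] is positive, where all terms of the
   reverse are nonnegative and one is positive. *)
Lemma real_gamma_root (C : numClosedFieldType) (n : nat) (z : C) : (1 < n)%N ->
  \sum_(i < (n./2).+1)
     ((fib_coef n i)%:R * 'C(n, i)%:R) * (z ^+ i * (1 + z) ^+ (n - 2 * i)) = 0 ->
  z \is Num.real.
Proof.
move=> n_gt1 sum0; have [->|z_neq0] := eqVneq z 0; first by rewrite real0.
have [z1|z1_neq0] := eqVneq (1 + z) 0.
  by rewrite (_ : z = -1) ?rpredN1 //; apply/eqP; rewrite -addr_eq0 addrC z1.
pose w := (1 + z) ^+ 2 / z.
have w_neq0 : w != 0 by rewrite mulf_neq0 ?expf_neq0 ?invr_eq0.
pose W : {poly C} :=
  \sum_(i < (n./2).+1) ((fib_coef n i)%:R * 'C(n, i)%:R) *: 'X^(n - i).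
have WE (y : C) : W.[y] =
    \sum_(i < (n./2).+1) ((fib_coef n i)%:R * 'C(n, i)%:R) * y ^+ (n - i).
  by rewrite horner_sum; apply: eq_bigr => i _; rewrite hornerZ hornerXn.
have Ww : W.[w] = 0.
  apply: (mulfI (expf_neq0 n z1_neq0)); rewrite mulr0 -[RHS](mulr0 (w ^+ n)).
  rewrite -sum0 WE !mulr_sumr; apply: eq_bigr => i _.
  have i_n : (2 * i <= n)%N by have := ltn_ord i; lia.
  have -> : (1 + z) ^+ n = (1 + z) ^+ (n - 2 * i) * (w ^+ i * z ^+ i).
    by rewrite -exprMn divfK // -exprM -exprD subnK.
  have -> : w ^+ n = w ^+ (n - i) * w ^+ i by rewrite -exprD subnK //; lia.
  ring.
have term_ge0 (y : C) (i : nat) : 0 < y ->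
    0 <= ((fib_coef n i)%:R * 'C(n, i)%:R) * y ^+ (n - i).
  by move=> y_gt0; rewrite !mulr_ge0 ?exprn_ge0 ?ler0n ?ltW.
have W_gt0 (y : C) : 0 < y -> 0 < W.[y].
  move=> y_gt0; have half_gt0 : (1 < (n./2).+1)%N by lia.
  (* The term [i = 1] has coefficient [n]. *)
  rewrite WE (bigD1 (Ordinal half_gt0)) //= ltr_pwDl ?sumr_ge0 //.
    by rewrite bin0 bin1 mul1r mulr_gt0 ?exprn_gt0 ?ltr0n // ltnW.
  by move=> i _; apply: term_ge0.
have W_real : real_rooted W.
  apply: (@real_rooted_bin_mul _ n _ (fun i => (fib_coef n i)%:R)).
  exact: real_rooted_fib.
have w_real : w \is Num.real.
  case: W_real => [W0|]; last by apply; rewrite /root Ww.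
  by have := W_gt0 1 ltr01; rewrite W0 horner0 ltxx.
have zc_neq0 : z^* != 0 by rewrite conjC_eq0.
(* As [w = z + 2 + 1 / z], this product is [z * z^* * (w^* - w)]. *)
have : (z^* - z) * (z * z^* - 1) = 0.
  have : w^* - w = 0 by rewrite (CrealP w_real) subrr.
  rewrite /w rmorphM rmorphXn rmorphD rmorph1 fmorphV => w0.
  rewrite -[RHS](mulr0 (z * z^*)) -w0.
  by field; rewrite z_neq0.
move/eqP; rewrite mulf_eq0 !subr_eq0 => /orP[/eqP/CrealP //|/eqP z_unit].
suff /W_gt0 : 0 < w by rewrite Ww ltxx.
(* The second summand vanishes on the unit circle. *)
have -> : w = (1 + z) * (1 + z^*) + (1 + z) * (1 - z * z^*) / z.
  by rewrite /w; field.
have -> : 1 + z^* = (1 + z)^* by rewrite rmorphD rmorph1.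
by rewrite z_unit subrr mulr0 mul0r addr0 -normCK exprn_gt0 ?normr_gt0.
Qed.

Theorem theorem3p3 (R : realType) (n : nat) (hn : (0 < n)%N) :
  has_only_real_zeros (local_h_B R n).
Proof.
have [n_gt1|n_le1] := ltnP 1 n; last first.
  by left; rewrite /local_h_B (_ : n = 1)%N ?big_geq //; lia.
right=> z; rewrite /root /local_h_B => /eqP z_root.
suff /Creal_ImP : z \is Num.real.
  by rewrite -complexIm => /complexI.
apply: (real_gamma_root n_gt1); rewrite -[RHS]z_root big_ord_recl mul0r mul0r add0r.
rewrite rmorph_sum horner_sum big_add1 big_mkord /=; apply: eq_bigr => i _.
rewrite map_polyZ rmorph_nat natrM rmorphM !rmorphXn rmorphD rmorph1 /= map_polyX.
rewrite hornerZ hornerM !horner_exp hornerD hornerX hornerC.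
by rewrite /bump add1n !subn1; congr (_ * _); apply: mulrC.
Qed.
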